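(* Let $G$ be a Lie group with Lie algebra $\mathfrak g$ and let $\mathcal D=\mathfrak g\ltimes\mathfrak g^*$ be the Lie algebra of $T^*G$. The group $\mathrm{Aut}(\mathcal D)$ of automorphisms of the Lie algebra $\mathcal D$ is a super symmetric Lie group; more precisely, its Lie algebra $\mathrm{der}(\mathcal D)$ (the derivations of $\mathcal D$) is a $\mathbb Z/2\mathbb Z$-graded Lie algebra which decomposes into a direct sum of vector spaces $$\mathrm{der}(\mathcal D)=\mathcal G_0\oplus\mathcal G_1,\qquad [\mathcal G_i,\mathcal G_{i'}]\subset\mathcal G_{i+i'},\quad i,i'\in\mathbb Z/2\mathbb Z=\{0,1\},$$ where $\mathcal G_0$ is the Lie algebra $$\mathcal G_0=\big\{\phi:\mathcal D\to\mathcal D,\ \phi(x,f)=\big(\alpha(x),\ f\circ(j-\alpha)\big)\ :\ \alpha\in\mathrm{der}(\mathfrak g),\ j\in\mathcal J\big\}$$ and $\mathcal G_1=\mathcal Q\oplus\Psi$ as a vector space. Moreover, $\mathcal Q$ and $\Psi$ are abelian subalgebras of $\mathrm{der}(\mathcal D)$, and $\mathcal G_0\oplus\mathcal Q$ and $\mathcal G_0\oplus\Psi$ are subalgebras of $\mathrm{der}(\mathcal D)$ which are Lie superalgebras, i.e. they are $\mathbb Z/2\mathbb Z$-graded Lie algebras whose Lie bracket satisfies $[x,y]=-(-1)^{\deg(x)\deg(y)}[y,x]$ for homogeneous $x,y$, where $\deg(x)=i$ if $x\in\mathcal G_i$.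
   Context: Lie groups and Lie algebras are real and finite dimensional. $ad^*_xf=-f\circ ad_x$ for $x\in\mathfrak g$, $f\in\mathfrak g^*$. The cotangent bundle $T^*G$ has the Lie group structure $G\ltimes\mathfrak g^*$ (coadjoint action), and $\mathcal D=\mathfrak g\ltimes\mathfrak g^*$ has bracket $[(x,f),(y,g)]=([x,y],\,ad^*_xg-ad^*_yf)$. $\mathrm{der}(\mathfrak g)$ is the Lie algebra of derivations of $\mathfrak g$. $\mathcal J$ is the space of linear maps $j:\mathfrak g\to\mathfrak g$ with $j([x,y])=[j(x),y]$ for all $x,y$. $\mathcal Q$ is the space of $1$-cocycles $\beta:\mathfrak g\to\mathfrak g^*$, i.e. linear maps with $\beta([x,y])=ad^*_x\beta(y)-ad^*_y\beta(x)$; it is viewed inside $\mathrm{der}(\mathcal D)$ via $\beta\mapsto\phi_\beta$, $\phi_\beta(x,f)=(0,\beta(x))$. $\Psi$ is the space of linear maps $\psi:\mathfrak g^*\to\mathfrak g$ with $\psi\circ ad^*_x=ad_x\circ\psi$ and $ad^*_{\psi(f)}g=ad^*_{\psi(g)}f$ for all $x\in\mathfrak g$, $f,g\in\mathfrak g^*$; it is viewed inside $\mathrm{der}(\mathcal D)$ via $\psi\mapsto\phi_\psi$, $\phi_\psi(x,f)=(\psi(f),0)$. ''Super symmetric Lie group'' means exactly that its Lie algebra has the $\mathbb Z/2\mathbb Z$-grading described in the claim. *)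

(* Defs.v *)
(* MathComp, with MathComp-Analysis for the topology on matrices. *)
From HB Require Import structures.
From mathcomp Require Import all_boot all_order all_algebra.
From mathcomp Require Import all_classical all_reals all_analysis.
From mathcomp Require Import ring.
Import Order.TTheory GRing.Theory Num.Theory.
Import numFieldNormedType.Exports.

Set Implicit Arguments.
Unset Strict Implicit.
Unset Printing Implicit Defensive.

Local Open Scope classical_set_scope.
Local Open Scope ring_scope.

HB.mixin Record Vector_isLieAlgebra (R : fieldType) L of Vector R L := {
  lieb : L -> L -> L;
  lieb_linearl : forall z, linear (lieb^~ z);
  lieb_linearr : forall x, linear (lieb x);
  lieb_alt : forall x, lieb x x = 0;
  lieb_jacobi : forall x y z,
    lieb x (lieb y z) + lieb y (lieb z x) + lieb z (lieb x y) = 0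
}.

#[short(type="lieAlgType")]
HB.structure Definition LieAlgebra (R : fieldType) :=
  { L of Vector R L & Vector_isLieAlgebra R L }.

Notation "[Lie x , y ]" := (lieb x y)
  (at level 0, x, y at level 99, format "[Lie  x ,  y ]") : ring_scope.

Section EndLie.
Variables (R : fieldType) (V : vectType R).

Definition commutator (f g : 'End(V)) : 'End(V) := ((f \o g) - (g \o f))%VF.

Fact commutator_linearl h : linear (commutator^~ h).
Proof.
move=> a f g; apply/lfunP => v.
rewrite /commutator !(add_lfunE, opp_lfunE, scale_lfunE, comp_lfunE).
by rewrite linearP /= scalerBr opprD addrACA.
Qed.

Fact commutator_linearr h : linear (commutator h).
Proof.
move=> a f g; apply/lfunP => v.
rewrite /commutator !(add_lfunE, opp_lfunE, scale_lfunE, comp_lfunE).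
by rewrite linearP /= scalerBr opprD addrACA.
Qed.

Fact commutator_alt f : commutator f f = 0.
Proof. by rewrite /commutator subrr. Qed.

Fact commutator_jacobi f g h :
  commutator f (commutator g h) + commutator g (commutator h f)
  + commutator h (commutator f g) = 0.
Proof.
apply/lfunP => v; rewrite /commutator.
rewrite !(add_lfunE, opp_lfunE, comp_lfunE, zero_lfunE) !linearB /=.
rewrite !opprK.
set A := f (g (h v)); set B := f (h (g v)); set C := g (h (f v)).
set D := h (g (f v)); set E := g (f (h v)); set F := h (f (g v)).
rewrite [LHS](AC ((2*2)*(2*2)*(2*2))
  ((1*11)*(8*2)*(5*3)*(4*10)*(9*7)*(12*6)))/=.
by rewrite !subrr !addr0.
Qed.

HB.instance Definition _ := Vector_isLieAlgebra.Build R 'End(V)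
  commutator_linearl commutator_linearr commutator_alt commutator_jacobi.
End EndLie.

Section Subspaces.
Variables (R : fieldType) (V : vectType R).

Definition is_subspace (A : set V) : Prop :=
  A 0 /\ forall (a : R) u v, A u -> A v -> A (a *: u + v).

Definition sum_set (A B : set V) : set V := [set u + v | u in A & v in B].

Definition direct_sum (C A B : set V) : Prop :=
  [/\ is_subspace A, is_subspace B, C = sum_set A B & A `&` B = [set 0]].
End Subspaces.

Section LieNotions.
Variables (R : fieldType) (L : lieAlgType R).

Definition lie_subalgebra (A : set L) : Prop :=
  is_subspace A /\ forall x y, A x -> A y -> A [Lie x, y].

Definition abelian_subalgebra (A : set L) : Prop :=
  lie_subalgebra A /\ forall x y, A x -> A y -> [Lie x, y] = 0.

Definition grading (A B : set L) (i : 'Z_2) : set L := if i == 0 then A else B.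

Definition Z2_graded (S : set L) (Gr : 'Z_2 -> set L) : Prop :=
  [/\ lie_subalgebra S, direct_sum S (Gr 0) (Gr 1) &
      forall (i i' : 'Z_2) x y, Gr i x -> Gr i' y -> Gr (i + i') [Lie x, y]].

(* Only the graded symmetry of the bracket is required, not the super-Jacobi
   identity; S is a Lie algebra, so its bracket satisfies the ordinary one. *)
Definition lie_superalgebra (S : set L) (Gr : 'Z_2 -> set L) : Prop :=
  Z2_graded S Gr /\
  forall (i i' : 'Z_2) x y, Gr i x -> Gr i' y ->
    [Lie x, y] = - ((-1) ^+ (i * i')%N *: [Lie y, x]).

Definition der : set 'End(L) :=
  [set phi : 'End(L) | forall x y,
     phi [Lie x, y] = [Lie phi x, y] + [Lie x, phi y]].

Definition Aut : set 'End(L) :=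
  [set phi : 'End(L) | bijective phi /\
     forall x y, phi [Lie x, y] = [Lie phi x, phi y]].

Definition ad (x : L) : 'End(L) := linfun (lieb x).
End LieNotions.

Section LinearGroups.
Variables (R : realType) (V : vectType R).

Definition GL : set 'End(V) := [set phi : 'End(V) | bijective phi].

Definition mx_of (phi : 'End(V)) : 'M[R]_(\dim {:V}) :=
  passmx.mxof (vbasis {:V}) (vbasis {:V}) phi.

Definition end_of (A : 'M[R]_(\dim {:V})) : 'End(V) :=
  passmx.hommx (vbasis {:V}) (vbasis {:V}) A.

(* The topology of End(V) is that of matrices in the basis vbasis {:V}; it does
   not depend on the basis. phi^-1 is a right pseudo-inverse in general, but the
   last clause makes H a subset of GL(V), where it is the inverse. A closed
   subgroup of GL(V) is a Lie group by Cartan's theorem. *)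
Definition closed_subgroup_GL (H : set 'End(V)) : Prop :=
  [/\ H \1%VF,
      forall phi psi, H phi -> H psi -> H (phi \o psi)%VF,
      forall phi, H phi -> H (phi^-1)%VF &
      exists C : set 'M[R]_(\dim {:V}), closed C /\ H = GL `&` (mx_of @^-1` C)].

Definition exp_mx n (A : 'M[R]_n) : 'M[R]_n :=
  limn (series (fun k => (k`!%:R)^-1 *: A ^+ k)).

Definition exp_end (X : 'End(V)) : 'End(V) := end_of (exp_mx (mx_of X)).

(* The Lie algebra of a closed subgroup H of GL(V): the generators of its
   one-parameter subgroups. *)
Definition lie_algebra_of (H : set 'End(V)) : set 'End(V) :=
  [set X | forall t : R, H (exp_end (t *: X))].

Definition super_symmetric_lie_group
    (H : set 'End(V)) (Gr : 'Z_2 -> set 'End(V)) : Prop :=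
  closed_subgroup_GL H /\ Z2_graded (lie_algebra_of H) Gr.
End LinearGroups.

Section Cotangent.
Variables (R : fieldType) (g : lieAlgType R).

Definition dual : vectType R := 'Hom(g, R^o).

Definition coad (x : g) (f : dual) : dual := (- (f \o ad x))%VF.

(* The Lie algebra of T^*G when g is that of G. It is the pair space, as an alias so that the semidirect bracket
   is not attached to every pair of this shape. *)
Definition cotangent : Type := (g * dual)%type.
HB.instance Definition _ := Vector.on cotangent.

Fact coadE (x : g) (f : dual) y : coad x f y = - f [Lie x, y].
Proof.
rewrite /coad opp_lfunE comp_lfunE /ad; congr (- f _).
pose h := GRing.isLinear.Build _ _ _ _ _ (@lieb_linearr _ _ x).
by rewrite (lfunE (HB.pack (lieb x) h : {linear g -> g})).
Qed.

Definition cot_lieb (u v : cotangent) : cotangent :=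
  ([Lie u.1, v.1], coad u.1 v.2 - coad v.1 u.2).

Let liebC (x y : g) : [Lie x, y] = - [Lie y, x].
Proof.
have D (u v w : g) : [Lie u + v, w] = [Lie u, w] + [Lie v, w].
  by have := lieb_linearl w 1 u v; rewrite !scale1r.
have Dr (u v w : g) : [Lie w, u + v] = [Lie w, u] + [Lie w, v].
  by have := lieb_linearr w 1 u v; rewrite !scale1r.
apply/eqP; rewrite -addr_eq0; apply/eqP.
by have := lieb_alt (x + y); rewrite D !Dr !lieb_alt add0r addr0.
Qed.

Fact cot_linearr u : linear (cot_lieb u).
Proof.
move=> a v w; apply/pair_equal_spec; split; first exact: lieb_linearr.
apply/lfunP => y.
rewrite /= !(coadE, add_lfunE, opp_lfunE, scale_lfunE).
rewrite lieb_linearl.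
rewrite [u.2 (_ + _)]linearP !opprK scalerDr scalerN opprD.
by rewrite addrACA.
Qed.

Fact cot_lieb_alt u : cot_lieb u u = 0.
Proof. by rewrite /cot_lieb lieb_alt subrr. Qed.

Let cot_liebC u v : cot_lieb u v = - cot_lieb v u.
Proof.
by apply/pair_equal_spec; split; rewrite /= ?opprB// -liebC.
Qed.

Fact cot_linearl w : linear (cot_lieb^~ w).
Proof.
by move=> a u v; rewrite cot_liebC cot_linearr opprD -scalerN -!cot_liebC.
Qed.

Fact cot_jacobi u v w :
  cot_lieb u (cot_lieb v w) + cot_lieb v (cot_lieb w u)
  + cot_lieb w (cot_lieb u v) = 0.
Proof.
apply/pair_equal_spec; split; first exact: lieb_jacobi.
have J (f : dual) (x y z : g) :
    f [Lie [Lie x, y], z] = f [Lie x, [Lie y, z]] - f [Lie y, [Lie x, z]].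
  rewrite -linearB /=; congr (f _).
  rewrite (liebC _ z) (liebC x z); apply/eqP.
  have -> : [Lie y, - [Lie z, x]] = - [Lie y, [Lie z, x]].
    have := lieb_linearr y (-1) [Lie z, x] 0.
    rewrite addr0 !scaleN1r => ->.
    have := lieb_linearr y (-1) 0 0.
    by rewrite scaler0 addr0 scaleN1r addNr => ->; rewrite addr0.
  by rewrite opprK eq_sym -addr_eq0 -(lieb_jacobi x y z).
apply/lfunP => y; rewrite zero_lfunE /=.
rewrite !(coadE, add_lfunE, opp_lfunE) !J.
have H (a b c d e k : R) : - (- a - - b) - - (c - d) +
  (- (- d - - e) - - (b - k)) + (- (- k - - c) - - (e - a)) = 0 by ring.
exact: H.
Qed.

HB.instance Definition _ := Vector_isLieAlgebra.Build R cotangent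
  cot_linearl cot_linearr cot_lieb_alt cot_jacobi.

Definition J_maps : set 'End(g) :=
  [set j | forall x y, j [Lie x, y] = [Lie j x, y]].

Definition Q_cocycles : set 'Hom(g, dual) :=
  [set beta | forall x y, beta [Lie x, y] = coad x (beta y) - coad y (beta x)].

Definition Psi_maps : set 'Hom(dual, g) :=
  [set psi | (forall x f, psi (coad x f) = [Lie x, psi f]) /\
             (forall f h, coad (psi f) h = coad (psi h) f)].

Definition G0 : set 'End(cotangent) :=
  [set phi | exists alpha j, [/\ der alpha, J_maps j &
     forall (x : g) (f : dual), phi (x, f) = (alpha x, (f \o (j - alpha))%VF)]].

(* calQ and calPsi are the images of Q_cocycles and Psi_maps in End(D). *)
Definition calQ : set 'End(cotangent) :=
  [set phi | exists2 beta, Q_cocycles beta &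
     forall (x : g) (f : dual), phi (x, f) = (0, beta x)].

Definition calPsi : set 'End(cotangent) :=
  [set phi | exists2 psi, Psi_maps psi &
     forall (x : g) (f : dual), phi (x, f) = (psi f, 0)].

Definition G1 : set 'End(cotangent) := sum_set calQ calPsi.
End Cotangent.

Arguments J_maps {R} g.
Arguments Q_cocycles {R} g.
Arguments Psi_maps {R} g.
Arguments G0 {R} g.
Arguments G1 {R} g.
Arguments calQ {R} g.
Arguments calPsi {R} g.
Arguments der {R} L.
Arguments Aut {R} L.

(* Main.v *)
Require Import Defs.
From HB Require Import structures.
From mathcomp Require Import all_boot all_order all_algebra.
From mathcomp Require Import all_classical all_reals all_analysis.
From mathcomp Require Import ring.

Set Implicit Arguments.
Unset Strict Implicit.
Unset Printing Implicit Defensive.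

Import Order.TTheory GRing.Theory Num.Theory.
Import numFieldNormedType.Exports.

Local Open Scope classical_set_scope.
Local Open Scope ring_scope.

(** Write g' for the dual of g, D = g + g' for the cotangent Lie algebra, and
    E for the projection E(x, f) = (0, f). The whole grading comes from one observation: E is a
    derivation of D, because D is graded by degree, with g in degree 0 and the
    abelian ideal g' in degree 1. Hence a := [E, -] acts on der(D), and by
    the Jacobi identity the subspaces
      W_k = { phi in der(D) | [E, phi] = k phi }           ([weight])
    satisfy [W_k, W_l] <= W_(k+l). As E is idempotent, a^3 = a
    ([lie_idem_cube]), so only the weights -1, 0 and 1 occur, and
      phi = (phi - a^2 phi) + a^2 phi
    splits der(D) into W_0 and the odd part { a^2 phi = phi } = W_1 + W_(-1)
    ([direct_der], [odd_derE]). Parity of the weight gives the Z/2-grading,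
    and W_1, W_(-1) are abelian since W_2 = W_(-2) = 0 ([lieb_weight_unit]).

    It remains to recognise the weight spaces. Writing an endomorphism of D as
    a 2 x 2 block matrix, [der_blocksP] translates the derivation property
    into one condition per block, and [weight_blocksP] says which blocks
    vanish in a given weight: the diagonal ones survive in weight 0, the block
    g -> g' in weight 1 and the block g' -> g in weight -1. This yields
    G0 = W_0, Q = W_1 and Psi = W_(-1) ([G0E], [calQE], [calPsiE]); in weight
    0 the map j of the statement is alpha + t, where the block g' -> g' is
    the transpose of t.

    The statements on Aut(D) hold for every Lie algebra L of finite dimension.
    Preserving the bracket is a system of polynomial equations in the matrix
    entries, so Aut(L) is closed in GL(L) ([closed_Aut]). That its Lie algebra
    is der(L) ([lie_algebra_of_Aut]) follows from d/dt exp(tX) = X exp(tX) =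
    exp(tX) X, which is proved entrywise from the derivative of a power series
    ([mx_derive_exp]). Differentiating exp(tX) ad_x = ad_(exp(tX) x) exp(tX)
    at t = 0 shows that X is a derivation. Conversely, for a derivation X the
    function exp(-tX) ad_(exp(tX) x) exp(tX) has derivative zero, so it is
    constantly ad_x, and exp(X) is an automorphism ([exp_der]). *)

(** * Lie algebras, derivations and gradings *)

Section LieTheory.
Variables (R : fieldType) (L : lieAlgType R).
Implicit Types (x y z : L).

HB.instance Definition _ x :=
  GRing.isLinear.Build R L L _ (lieb x) (lieb_linearr x).

Lemma liebC x y : [Lie x, y] = - [Lie y, x].
Proof.
have D u v w : [Lie u + v, w] = [Lie u, w] + [Lie v, w].
  by have := lieb_linearl w 1 u v; rewrite !scale1r.
apply/eqP; rewrite -addr_eq0; apply/eqP.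
by have := lieb_alt (x + y); rewrite D !linearD /= !lieb_alt add0r addr0.
Qed.

Lemma liebDl x y z : [Lie x + y, z] = [Lie x, z] + [Lie y, z].
Proof. by rewrite liebC linearD /= opprD -!liebC. Qed.

Lemma liebDr x y z : [Lie z, x + y] = [Lie z, x] + [Lie z, y].
Proof. exact: linearD. Qed.

Lemma liebNl x y : [Lie - x, y] = - [Lie x, y].
Proof. by rewrite liebC linearN /= opprK liebC. Qed.

Lemma liebNr x y : [Lie x, - y] = - [Lie x, y].
Proof. exact: linearN. Qed.

Lemma liebZl a x y : [Lie a *: x, y] = a *: [Lie x, y].
Proof. by rewrite liebC linearZ /= -scalerN -liebC. Qed.

Lemma liebZr a x y : [Lie x, a *: y] = a *: [Lie x, y].
Proof. exact: linearZ. Qed.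

Lemma lieb0l x : [Lie 0, x] = 0.
Proof. by rewrite liebC !linear0. Qed.

Lemma lieb0r x : [Lie x, 0] = 0.
Proof. exact: linear0. Qed.

(** The Jacobi identity in the form used for weights: bracketing with a fixed
    element is a derivation. *)
Lemma lieb_leibniz x y z :
  [Lie x, [Lie y, z]] = [Lie [Lie x, y], z] + [Lie y, [Lie x, z]].
Proof.
have := lieb_jacobi x y z.
rewrite (liebC z x) liebNr (liebC z [Lie x, y]) -addrA -opprD => /subr0_eq ->.
by rewrite addrC.
Qed.

Lemma adE x y : ad x y = [Lie x, y].
Proof. by rewrite /ad lfunE. Qed.

End LieTheory.

Section Derivations.
Variables (R : fieldType) (L : lieAlgType R).

Lemma lie_endE (phi psi : 'End(L)) x :
  [Lie phi, psi] x = phi (psi x) - psi (phi x).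
Proof.
change ([Lie phi, psi] x) with (commutator phi psi x).
by rewrite /commutator add_lfunE opp_lfunE !comp_lfunE.
Qed.

Lemma der_subspace : is_subspace (der L).
Proof.
split=> [x y|a phi psi dphi dpsi x y].
  by rewrite !zero_lfunE (liebC 0) !linear0 addr0.
rewrite !add_lfunE !scale_lfunE dphi dpsi !(liebDl, liebDr) liebZl liebZr.
by rewrite scalerDr addrACA.
Qed.

Lemma der_lie_subalgebra : lie_subalgebra (der L).
Proof.
split; first exact: der_subspace.
move=> phi psi dphi dpsi x y.
rewrite !lie_endE dphi dpsi !linearD /= !dphi !dpsi !(liebDl, liebDr).
rewrite !(liebNl, liebNr).
set A := [Lie phi (psi x), y]; set B := [Lie psi (phi x), y].
set C := [Lie phi x, psi y]; set D := [Lie psi x, phi y].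
set E := [Lie x, phi _]; set F := [Lie x, psi _].
rewrite !opprD [LHS](AC ((2*2)*(2*2)) ((1*5)*(4*8)*(2*7)*(3*6)))/=.
by rewrite subrr addrN !addr0.
Qed.

End Derivations.

Section Subspaces.
Variables (R : fieldType) (V : vectType R).
Implicit Types (A B : set V).

Lemma is_subspaceD A u v : is_subspace A -> A u -> A v -> A (u + v).
Proof. by move=> [_ AP] Au Av; rewrite -[u]scale1r; exact: AP. Qed.

Lemma is_subspaceZ A a u : is_subspace A -> A u -> A (a *: u).
Proof. by move=> [A0 AP] Au; rewrite -[_ *: _]addr0; exact: AP. Qed.

Lemma is_subspaceN A u : is_subspace A -> A u -> A (- u).
Proof. by move=> sA Au; rewrite -scaleN1r; exact: is_subspaceZ. Qed.

Lemma sum_set_subspace A B :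
  is_subspace A -> is_subspace B -> is_subspace (sum_set A B).
Proof.
move=> [A0 AP] [B0 BP]; split.
  by exists 0 => //; exists 0; rewrite ?addr0.
move=> a _ _ [u Au [v Bv <-]] [u' Au' [v' Bv' <-]].
exists (a *: u + u'); first exact: AP.
by exists (a *: v + v'); [exact: BP | rewrite scalerDr addrACA].
Qed.

End Subspaces.

Section Gradings.
Variables (R : fieldType) (L : lieAlgType R).

(** Antisymmetry supplies the bracket of an odd with an even element, and the
    four inclusions make the sum of the two parts a subalgebra. *)
Lemma Z2_gradedI (S A B : set L) : direct_sum S A B ->
  (forall x y, A x -> A y -> A [Lie x, y]) ->
  (forall x y, A x -> B y -> B [Lie x, y]) ->
  (forall x y, B x -> B y -> A [Lie x, y]) ->
  Z2_graded S (grading A B).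
Proof.
move=> dS AA AB BB; have [sA sB SE _] := dS.
have BA x y : B x -> A y -> B [Lie x, y].
  by move=> Bx Ay; rewrite liebC; apply: is_subspaceN => //; exact: AB.
split => //.
  rewrite SE; split; first exact: sum_set_subspace.
  move=> _ _ [u Au [v Bv <-]] [u' Au' [v' Bv' <-]].
  exists ([Lie u, u'] + [Lie v, v']).
    by apply: is_subspaceD => //; [exact: AA | exact: BB].
  exists ([Lie u, v'] + [Lie v, u']).
    by apply: is_subspaceD => //; [exact: AB | exact: BA].
  rewrite liebDl !liebDr -!addrA; congr (_ + _).
  by rewrite addrC -addrA.
case=> [] [|[|//]] ? [] [|[|//]] ? x y; rewrite /grading /=.
- exact: AA.
- exact: AB.
- exact: BA.
- exact: BB.
Qed.

(** The sign (-1)^(ii') differs from 1 only for two odd elements, so graded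
    symmetry amounts to [x, y] = [y, x] there. It holds together with ordinary
    antisymmetry when odd elements commute. *)
Lemma lie_superalgebraI (S A B : set L) : Z2_graded S (grading A B) ->
  (forall x y, B x -> B y -> [Lie x, y] = 0) ->
  lie_superalgebra S (grading A B).
Proof.
move=> gS BB; split=> //.
case=> [] [|[|//]] ? [] [|[|//]] ? x y; rewrite /grading /=.
- by rewrite mul0n expr0 scale1r -liebC.
- by rewrite mul0n expr0 scale1r -liebC.
- by rewrite muln0 expr0 scale1r -liebC.
- by move=> Bx By; rewrite !BB// scaler0 oppr0.
Qed.

End Gradings.

(** * The exponential of a matrix and its derivative *)

Section MatrixExponential.
Variable R : realType.

Lemma cvg_mx_entries m n (u : nat -> 'M[R]_(m, n)) (M : 'M[R]_(m, n)) :
  (forall i j, (fun k => u k i j) @ \oo --> M i j) -> u @ \oo --> M.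
Proof.
move=> uM A [P PM PA].
have : \forall k \near \oo, forall ij : 'I_m * 'I_n,
    P ij.1 ij.2 (u k ij.1 ij.2).
  by apply: filter_forall => ij; exact: uM (PM ij.1 ij.2).
by apply: filterS => k Pu; apply: PA => i j; exact: Pu (i, j).
Qed.

(** The constant is the sum of the absolute values of all entries, which
    dominates every row sum; hence the induction on the exponent. *)
Lemma norm_mxX_le n (A : 'M[R]_n) :
  exists2 c : R, 0 <= c & forall k i j, `|(A ^+ k) i j| <= c ^+ k.
Proof.
exists (\sum_i \sum_j `|A i j|).
  by apply: sumr_ge0 => i _; apply: sumr_ge0.
move=> k; elim: k => [|k IHk] i j.
  rewrite !expr0 -[1 in X in `|X| <= _]/(1%:M) mxE.
  by case: eqP; rewrite ?normr1 ?normr0.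
rewrite !exprS mxE (le_trans (ler_norm_sum _ _ _))//.
rewrite (@le_trans _ _ (\sum_l `|A i l| * (\sum_i \sum_j `|A i j|) ^+ k))//.
  by apply: ler_sum => l _; rewrite normrM ler_wpM2l.
rewrite -mulr_suml ler_wpM2r//.
  by rewrite exprn_ge0//; apply: sumr_ge0 => ? _; apply: sumr_ge0.
rewrite [leRHS](bigD1 i)//= lerDl.
by apply: sumr_ge0 => ? _; apply: sumr_ge0.
Qed.

(** Comparison with the series of M exp(c |x|). The factor M lets the same
    bound serve the shifted sequences that arise by differentiation. *)
Lemma is_cvg_exp_pseries (b : nat -> R) (M c x : R) : 0 <= c -> 0 <= M ->
  (forall k, `|b k| <= M * c ^+ k) ->
  cvgn (pseries (fun k => b k / k`!%:R) x).
Proof.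
move=> c0 M0 bM; apply: normed_cvg.
apply: (@series_le_cvg _ _ (fun k => M * exp_coeff (c * `|x|) k)).
- by move=> k; exact: normr_ge0.
- by move=> k; rewrite mulr_ge0// exp_coeff_ge0// mulr_ge0.
- move=> k; rewrite /exp_coeff /= !normrM normfV normrX normr_nat exprMn.
  rewrite -!mulrA mulrA [leRHS](_ : _ = (M * c ^+ k) * (k`!%:R^-1 * `|x| ^+ k)).
    by rewrite -mulrA ler_wpM2r ?bM// mulr_ge0// ?invr_ge0// exprn_ge0.
  by rewrite -!mulrA [_^-1 * _]mulrC.
- apply: is_cvg_seriesZ; exact: is_cvg_series_exp_coeff.
Qed.

(** Differentiating a series of exponential type shifts the sequence b, so
    for b k = (A^k)_ij it multiplies A^k by A. *)
Lemma pseries_diffs_fact (b : nat -> R) :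
  pseries_diffs (fun k => b k / k`!%:R) = (fun k => b k.+1 / k`!%:R).
Proof.
apply/funext => k; rewrite /pseries_diffs factS natrM invfM.
by rewrite mulrCA [k.+1%:R * _]mulrA mulfV ?mul1r// pnatr_eq0.
Qed.

Definition exp_coef n (A : 'M[R]_n) i j (k : nat) : R := (A ^+ k) i j / k`!%:R.

(** The exponents m = 0, 1, 2 give the series of an entry of exp(xA) and its
    first two formal derivatives. *)
Lemma is_cvg_exp_coef n (A : 'M[R]_n) i j (m : nat) x :
  cvgn (pseries (fun k => (A ^+ (m + k)) i j / k`!%:R) x).
Proof.
have [c c0 Ac] := norm_mxX_le A.
apply: (@is_cvg_exp_pseries _ (c ^+ m) c) => //; first exact: exprn_ge0.
by move=> k; rewrite -exprD.
Qed.

Lemma cvg_exp_coef n (A : 'M[R]_n) i j x :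
  pseries (exp_coef A i j) x @ \oo --> limn (pseries (exp_coef A i j) x).
Proof. exact: (@is_cvg_exp_coef _ A i j 0 x). Qed.

Lemma cvg_pseries_entries n (A : 'M[R]_n) x i j :
  (fun N => series (fun k => (k`!%:R)^-1 *: (x *: A) ^+ k) N i j) =
  pseries (exp_coef A i j) x.
Proof.
have expZ k : (x *: A) ^+ k = x ^+ k *: A ^+ k.
  elim: k => [|k IHk]; first by rewrite !expr0 scale1r.
  rewrite !exprS IHk -[LHS]/((x *: A) *m (x ^+ k *: A ^+ k)).
  by rewrite -scalemxAl -scalemxAr scalerA.
apply/funext => N; rewrite /series /= summxE; apply: eq_bigr => k _.
by rewrite mxE expZ mxE /exp_coef mulrC [x ^+ k * _]mulrC mulrAC.
Qed.

Lemma exp_mxE n (A : 'M[R]_n) x i j :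
  exp_mx (x *: A) i j = limn (pseries (exp_coef A i j) x).
Proof.
pose M := \matrix_(i, j) limn (pseries (exp_coef A i j) x) : 'M[R]_n.
suff -> : exp_mx (x *: A) = M by rewrite mxE.
apply: cvg_lim => //; apply: cvg_mx_entries => k l.
by rewrite cvg_pseries_entries mxE; exact: cvg_exp_coef.
Qed.

Lemma exp_mx0 n : exp_mx (0 : 'M[R]_n) = 1%:M.
Proof.
rewrite -(scale0r (0 : 'M[R]_n)); apply/matrixP => i j; rewrite exp_mxE.
(* From the first partial sum on, the series is constant. *)
apply: cvg_lim => //; rewrite -(cvg_shiftS _).
have -> : (fun N => pseries (exp_coef 0 i j) 0 N.+1) =
    cst ((1%:M : 'M[R]_n) i j).
  apply/funext => N; rewrite /pseries /series /= big_nat_recl// big1 => [|k _].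
    by rewrite /exp_coef !expr0 fact0 divr1 mulr1 addr0.
  by rewrite [0 ^+ _]exprS mul0r mulr0.
exact: cvg_cst.
Qed.

(** Entrywise differentiation reduces all calculus here to functions of one
    real variable. *)
Definition mx_derive m n (F : R -> 'M[R]_(m, n)) (t : R) (D : 'M[R]_(m, n)) :=
  forall i j, is_derive t 1 (fun s => F s i j) (D i j).

Lemma is_derive_exp_mx n (A : 'M[R]_n) t i j :
  is_derive t (1 : R) (fun s => exp_mx (s *: A) i j)
    (limn (pseries (fun k => (A ^+ k.+1) i j / k`!%:R) t)).
Proof.
have -> : (fun s => exp_mx (s *: A) i j) =
    (fun s => limn (pseries (exp_coef A i j) s)).
  by apply/funext => s; exact: exp_mxE.
rewrite -(pseries_diffs_fact (fun k => (A ^+ k) i j)).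
(* Any point beyond |t| serves as radius, since the series converges on R. *)
apply: (@pseries_snd_diffs _ _ (`|t| + 1)).
- exact: (@is_cvg_exp_coef _ A i j 0).
- by rewrite pseries_diffs_fact; exact: (@is_cvg_exp_coef _ A i j 1).
- by rewrite !pseries_diffs_fact; exact: (@is_cvg_exp_coef _ A i j 2).
- by rewrite [ltRHS]ger0_norm ?ltrDl// addr_ge0.
Qed.

(** The two forms of the derivative come from A^(k+1) = A A^k and
    A^(k+1) = A^k A. *)
Lemma mx_derive_exp n (A : 'M[R]_n) t :
  mx_derive (fun s => exp_mx (s *: A)) t (A *m exp_mx (t *: A)) /\
  mx_derive (fun s => exp_mx (s *: A)) t (exp_mx (t *: A) *m A).
Proof.
have cvgE k l : pseries (exp_coef A k l) t @ \oo --> exp_mx (t *: A) k l.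
  by rewrite exp_mxE; exact: cvg_exp_coef.
split=> i j; apply: is_derive_eq (is_derive_exp_mx _ _ _ _) _.
  apply: cvg_lim => //; rewrite mxE.
  have -> : pseries (fun k => (A ^+ k.+1) i j / k`!%:R) t =
      (fun N => \sum_l A i l * pseries (exp_coef A l j) t N).
    apply/funext => N; rewrite /pseries /series /=.
    under [RHS]eq_bigr do rewrite mulr_sumr.
    rewrite exchange_big; apply: eq_bigr => k _ /=.
    rewrite exprS mxE !mulr_suml; apply: eq_bigr => l _.
    by rewrite /exp_coef !mulrA.
  apply: (@cvg_big _ _ +%R); first exact: add_continuous.
  by move=> l _; apply: cvgM; [exact: cvg_cst | exact: cvgE].
apply: cvg_lim => //; rewrite mxE.
have -> : pseries (fun k => (A ^+ k.+1) i j / k`!%:R) t =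
    (fun N => \sum_l pseries (exp_coef A i l) t N * A l j).
  apply/funext => N; rewrite /pseries /series /=.
  under [RHS]eq_bigr do rewrite mulr_suml.
  rewrite exchange_big; apply: eq_bigr => k _ /=.
  rewrite exprSr mxE !mulr_suml; apply: eq_bigr => l _.
  by rewrite /exp_coef -!mulrA; congr (_ * _); rewrite mulrC mulrA.
apply: (@cvg_big _ _ +%R); first exact: add_continuous.
by move=> l _; apply: cvgM; [exact: cvgE | exact: cvg_cst].
Qed.

Lemma mx_derive_mul m n p (F : R -> 'M[R]_(m, n)) (G : R -> 'M[R]_(n, p))
    t DF DG :
  mx_derive F t DF -> mx_derive G t DG ->
  mx_derive (fun s => F s *m G s) t (DF *m G t + F t *m DG).
Proof.
move=> dF dG i j.
have -> : (fun s => (F s *m G s) i j) =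
    \sum_k ((fun s => F s i k) * (fun s => G s k j)).
  by apply/funext => s; rewrite mxE fct_sumE.
rewrite !mxE -big_split /=.
apply: is_derive_sum => k; apply: is_derive_eq.
  exact: is_deriveM (dF i k) (dG k j).
by rewrite addrC [_ *: DF _ _]mulrC.
Qed.

(** Entries of a linear image are fixed linear combinations of the entries,
    so they inherit both differentiability and continuity. *)
Lemma mx_linear_entries m n p q (f : 'M[R]_(m, n) -> 'M[R]_(p, q)) A k l :
  linear f -> f A k l = \sum_i \sum_j f (delta_mx i j) k l * A i j.
Proof.
move=> lf; pose h := GRing.isLinear.Build _ _ _ _ f lf.
pose f' := HB.pack f h : {linear 'M[R]_(m, n) -> 'M[R]_(p, q)}.
rewrite -[f]/(f' : _ -> _) {1}[A]matrix_sum_delta linear_sum summxE.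
apply: eq_bigr => i _; rewrite linear_sum summxE; apply: eq_bigr => j _.
by rewrite linearZ mxE mulrC.
Qed.

Lemma mx_derive_linear m n p q (f : 'M[R]_(m, n) -> 'M[R]_(p, q))
    (F : R -> 'M[R]_(m, n)) t DF : linear f ->
  mx_derive F t DF -> mx_derive (fun s => f (F s)) t (f DF).
Proof.
move=> lf dF k l.
have -> : (fun s => f (F s) k l) =
    \sum_i \sum_j (f (delta_mx i j) k l \*: (fun s => F s i j)).
  apply/funext => s; rewrite mx_linear_entries// fct_sumE.
  by apply: eq_bigr => i _; rewrite fct_sumE.
rewrite mx_linear_entries//.
by apply: is_derive_sum => i; apply: is_derive_sum => j; exact: is_deriveZ.
Qed.

Lemma mx_derive0_cst m n (F : R -> 'M[R]_(m, n)) :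
  (forall t, mx_derive F t 0) -> forall s t, F s = F t.
Proof.
move=> dF s t; apply/matrixP => i j.
apply: (@is_derive_0_is_cst _ (fun s => F s i j)) => x.
by have := dF x i j; rewrite mxE.
Qed.

Lemma mx_derive_uniq m n (F : R -> 'M[R]_(m, n)) t D D' :
  mx_derive F t D -> mx_derive F t D' -> D = D'.
Proof.
move=> dF dF'; apply/matrixP => i j.
by rewrite -(@derive_val _ _ _ _ _ _ _ (dF i j))
  (@derive_val _ _ _ _ _ _ _ (dF' i j)).
Qed.

End MatrixExponential.

(** * One-parameter groups of endomorphisms *)

Section EndCalculus.
Variables (R : realType) (V : vectType R).
Implicit Types (X : 'End(V)) (F G : R -> 'End(V)).

Let vbP : basis_of {:V} (vbasis {:V}) := vbasisP {:V}.

Lemma mx_ofK : cancel (@mx_of R V) (@end_of R V).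
Proof. exact: (passmx.mxofK vbP vbP). Qed.

Lemma end_ofK : cancel (@end_of R V) (@mx_of R V).
Proof. exact: (passmx.hommxK vbP vbP). Qed.

Lemma mx_of_linear : linear (@mx_of R V).
Proof. exact: passmx.mxof_linear. Qed.

Lemma end_of_linear : linear (@end_of R V).
Proof. exact: passmx.hommx_linear. Qed.

HB.instance Definition _ :=
  GRing.isLinear.Build R 'End(V) 'M[R]_(\dim {:V}) _ (@mx_of R V) mx_of_linear.

Lemma mx_of_comp (f h : 'End(V)) : mx_of (f \o h)%VF = mx_of h *m mx_of f.
Proof. exact: (@passmx.mxof_comp _ _ _ _ _ _ _ vbP). Qed.

Definition end_derive F t D := mx_derive (fun s => mx_of (F s)) t (mx_of D).

Lemma end_derive_comp F G t DF DG :
  end_derive F t DF -> end_derive G t DG ->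
  end_derive (fun s => F s \o G s)%VF t ((DF \o G t) + (F t \o DG))%VF.
Proof.
move=> dF dG; rewrite /end_derive linearD /= !mx_of_comp addrC.
under eq_fun do rewrite mx_of_comp.
exact: mx_derive_mul.
Qed.

Lemma end_derive_linear (f : 'End(V) -> 'End(V)) F t D : linear f ->
  end_derive F t D -> end_derive (fun s => f (F s)) t (f D).
Proof.
move=> lf dF; rewrite /end_derive -[D]mx_ofK.
have -> : (fun s => mx_of (f (F s))) =
    (fun s => (@mx_of R V \o f \o @end_of R V) (mx_of (F s))).
  by apply/funext => s /=; rewrite mx_ofK.
apply: (@mx_derive_linear _ _ _ _ _ (@mx_of R V \o f \o @end_of R V)) => //.
by move=> a A B /=; rewrite end_of_linear lf mx_of_linear.
Qed.

Lemma end_derive_cst (c : 'End(V)) t : end_derive (fun _ => c) t 0.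
Proof.
move=> i j; have -> : mx_of (0 : 'End(V)) i j = 0 by rewrite linear0 mxE.
exact: (is_derive_cst (mx_of c i j : R^o)).
Qed.

Lemma end_derive0_cst F : (forall t, end_derive F t 0) -> forall s t, F s = F t.
Proof.
move=> dF s t; apply: (can_inj mx_ofK).
apply: (@mx_derive0_cst _ _ _ (fun s => mx_of (F s))) => x.
by have := dF x; rewrite /end_derive linear0.
Qed.

Lemma end_derive_uniq F t D D' :
  end_derive F t D -> end_derive F t D' -> D = D'.
Proof.
by move=> dF dF'; apply: (can_inj mx_ofK); exact: mx_derive_uniq dF dF'.
Qed.

Lemma exp_end0 : exp_end (0 : 'End(V)) = \1%VF.
Proof. by rewrite /exp_end linear0 exp_mx0; exact: (passmx.hommx1 vbP). Qed.

Lemma end_derive_exp X t :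
  end_derive (fun s => exp_end (s *: X)) t (X \o exp_end (t *: X))%VF /\
  end_derive (fun s => exp_end (s *: X)) t (exp_end (t *: X) \o X)%VF.
Proof.
have mxE s : mx_of (exp_end (s *: X)) = exp_mx (s *: mx_of X).
  by rewrite /exp_end end_ofK linearZ.
have [dl dr] := mx_derive_exp (mx_of X) t.
by rewrite /end_derive; under eq_fun do rewrite mxE; rewrite !mx_of_comp mxE.
Qed.

(** By the product rule exp(-tX) exp(tX) has derivative
    exp(-tX) (-X) exp(tX) + exp(-tX) X exp(tX) = 0. *)
Lemma exp_endN X t : (exp_end (t *: - X) \o exp_end (t *: X))%VF = \1%VF.
Proof.
pose F s := (exp_end (s *: - X) \o exp_end (s *: X))%VF.
transitivity (F 0); last by rewrite /F !scale0r exp_end0 comp_lfun1l.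
apply: end_derive0_cst => s.
have [_ dN] := end_derive_exp (- X) s; have [dX _] := end_derive_exp X s.
have := end_derive_comp dN dX; congr end_derive.
by rewrite -comp_lfunA comp_lfunNl comp_lfunNr addNr.
Qed.

Lemma exp_end_bij X : bijective (exp_end X).
Proof.
exists (exp_end (- X)) => x.
  have := exp_endN X 1; rewrite !scale1r => /lfunP/(_ x).
  by rewrite comp_lfunE id_lfunE.
have := exp_endN (- X) 1; rewrite !scale1r opprK => /lfunP/(_ x).
by rewrite comp_lfunE id_lfunE.
Qed.

End EndCalculus.

(** * The automorphism group of a Lie algebra and its Lie algebra *)

Section AutLie.
Variables (R : realType) (L : lieAlgType R).
Implicit Types (phi X : 'End(L)).

Lemma ad_app_linear (x : L) : linear (fun phi : 'End(L) => ad (phi x)).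
Proof.
move=> a f h; apply/lfunP => y.
by rewrite !(add_lfunE, scale_lfunE, adE) liebDl liebZl.
Qed.

(** A quadratic condition in phi between endomorphisms, hence one that the
    product rule can differentiate. *)
Lemma AutP phi : Aut L phi <->
  bijective phi /\ forall x, (phi \o ad x)%VF = (ad (phi x) \o phi)%VF.
Proof.
split=> -[bij phiM]; split=> //.
  by move=> x; apply/lfunP => y; rewrite !(comp_lfunE, adE) phiM.
by move=> x y; have /lfunP/(_ y) := phiM x; rewrite !(comp_lfunE, adE).
Qed.

Lemma derP X : der L X <->
  forall x, (X \o ad x)%VF = (ad (X x) + (ad x \o X))%VF.
Proof.
split=> [dX x|dX x y].
  by apply/lfunP => y; rewrite add_lfunE !(comp_lfunE, adE) dX.
by have /lfunP/(_ y) := dX x; rewrite add_lfunE !(comp_lfunE, adE).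
Qed.

(** The curve H(s) = exp(-sX) ad_(exp(sX) x) exp(sX) is constant: with
    y = exp(sX) x its derivative is exp(-sX) (- X ad_y + ad_(X y) + ad_y X)
    exp(sX), which vanishes because X is a derivation. *)
Lemma exp_der X : der L X -> Aut L (exp_end X).
Proof.
move=> /derP dX; apply/AutP; split; first exact: exp_end_bij.
move=> x.
pose F s := exp_end (s *: X); pose F' s := exp_end (s *: - X).
pose H s := (F' s \o (ad (F s x) \o F s))%VF.
have H_cst : H 1 = H 0.
  apply: end_derive0_cst => s.
  have [_ dF'] := end_derive_exp (- X) s; have [dF _] := end_derive_exp X s.
  have := end_derive_comp dF' (end_derive_comp
    (end_derive_linear (ad_app_linear x) dF) dF).
  congr end_derive.
  rewrite -/(F s) -/(F' s) comp_lfunE comp_lfunNr comp_lfunNl.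
  rewrite [((ad (F s x)) \o (X \o _))%VF]comp_lfunA -comp_lfunDl -dX.
  by rewrite -!comp_lfunA addNr.
have FF' : (F 1 \o F' 1)%VF = \1%VF.
  by have := exp_endN (- X) 1; rewrite opprK.
move: H_cst; rewrite /H /F' /F !scale0r !exp_end0 id_lfunE.
rewrite -/(F' 1) comp_lfun1l comp_lfun1r => /(congr1 (comp_lfun (F 1))).
by rewrite comp_lfunA FF' comp_lfun1l /F scale1r => ->.
Qed.

(** One inclusion is [exp_der] for the multiples of X; for the other, both
    sides of the equation in [AutP] along exp(sX) are differentiated at 0. *)
Lemma lie_algebra_of_Aut : lie_algebra_of (Aut L) = der L.
Proof.
apply/seteqP; split=> X; last first.
  move=> dX t; apply: exp_der.
  exact: (is_subspaceZ _ (der_subspace L)).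
move=> autX; apply/derP => x.
have [dX _] := end_derive_exp X 0.
have dl := end_derive_comp dX (end_derive_cst (ad x) 0).
have dr := end_derive_comp (end_derive_linear (ad_app_linear x) dX) dX.
have E : (fun s => exp_end (s *: X) \o ad x)%VF =
    (fun s => ad (exp_end (s *: X) x) \o exp_end (s *: X))%VF.
  by apply/funext => s; have /AutP[_] := autX s; exact.
move: dl; rewrite E => /end_derive_uniq/(_ dr).
by rewrite scale0r exp_end0 !comp_lfun1r comp_lfun0r addr0 id_lfunE => ->.
Qed.

Lemma Aut_comp phi psi : Aut L phi -> Aut L psi -> Aut L (phi \o psi)%VF.
Proof.
move=> [bphi phiM] [bpsi psiM]; split; last first.
  by move=> x y; rewrite !comp_lfunE psiM phiM.
have [k psiK kpsi] := bpsi; have [l phiK lphi] := bphi.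
by exists (k \o l) => x; rewrite /= comp_lfunE ?phiK ?psiK ?kpsi ?lphi.
Qed.

Lemma Aut_inv phi : Aut L phi -> Aut L (phi^-1)%VF.
Proof.
move=> [[k phiK kphi] phiM].
have invE : (phi^-1)%VF =1 k.
  move=> x; rewrite -{1}[x]kphi.
  have /lker0_lfunK : lker phi == 0%VS.
    apply/lker0P; exact: can_inj phiK.
  exact.
split=> [|x y].
  by exists phi => x; rewrite invE.
by rewrite !invE -{1}[x]kphi -{1}[y]kphi -phiM phiK.
Qed.

Lemma continuous_mx_linear n p (f : 'M[R]_n -> 'M[R]_p) k l : linear f ->
  continuous (fun A => f A k l).
Proof.
move=> lf; rewrite (funext (fun A => mx_linear_entries A k l lf)).
apply: (@continuous_big _ _ +%R); first exact: add_continuous.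
move=> i _; apply: (@continuous_big _ _ +%R); first exact: add_continuous.
move=> j _ A.
apply: (@continuousM _ _ (cst (f (delta_mx i j) k l))
  (fun A : 'M[R]_n => A i j)).
  exact: cst_continuous.
exact: coord_continuous.
Qed.

Lemma continuous_mulmx_linear m n p q (f : 'M[R]_n -> 'M[R]_(p, m))
  (h : 'M[R]_n -> 'M[R]_(m, q)) i j :
  (forall k l, continuous (fun A => f A k l)) ->
  (forall k l, continuous (fun A => h A k l)) ->
  continuous (fun A => (f A *m h A) i j).
Proof.
move=> cf ch; rewrite (funext (fun A => mxE _ _ i j : (f A *m h A) i j = _)).
apply: (@continuous_big _ _ +%R); first exact: add_continuous.
move=> k _ A.
apply: (@continuousM _ _ (fun A => f A i k) (fun A => h A k j)).
  exact: cf.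
exact: ch.
Qed.

(** In the coordinates of [mx_of] the defect in [AutP] has entries that are
    polynomials of degree at most two in those of the matrix. *)
Lemma closed_Aut : closed_subgroup_GL (Aut L).
Proof.
split; [|exact: Aut_comp|exact: Aut_inv|].
  by split=> [|x y]; [exists id => x|]; rewrite !id_lfunE.
pose bracket_defect (x : L) A :=
  mx_of ((end_of A \o ad x) - (ad (end_of A x) \o end_of A))%VF.
exists (\bigcap_x \bigcap_(ij in setT)
  ((fun A => bracket_defect x A ij.1 ij.2) @^-1` [set 0])).
split.
  apply: closed_bigI => x _; apply: closed_bigI => -[i j] _.
  apply: preimage_closed; last exact: closed_eq.
  move=> A _; rewrite /bracket_defect /=.
  have -> : (fun A => mx_of ((end_of A \o ad x)
        - (ad (end_of A x) \o end_of A))%VF i j) =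
     (fun A => (mx_of (ad x) *m A) i j - (A *m mx_of (ad (end_of A x))) i j).
    apply/funext => B; rewrite linearB /= !mx_of_comp !end_ofK.
    by rewrite [LHS]mxE [X in _ + X]mxE.
  have left_cont : continuous (fun A => (mx_of (ad x) *m A) i j).
    apply: (@continuous_mulmx_linear _ _ _ _ (fun _ => mx_of (ad x)) id).
      by move=> k l; exact: cst_continuous.
    by move=> k l; exact: coord_continuous.
  have right_cont : continuous (fun A : 'M[R]_(\dim {:L}) =>
      (A *m mx_of (ad (end_of A x))) i j).
    apply: (@continuous_mulmx_linear _ _ _ _ id
      (fun A => mx_of (ad (end_of A x)))).
      by move=> k l; exact: coord_continuous.
    move=> k l.
    apply: (@continuous_mx_linear _ _ (fun A => mx_of (ad (end_of A x)))).
    by move=> a B C; rewrite end_of_linear ad_app_linear mx_of_linear.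
  exact: continuousB (left_cont A) (right_cont A).
apply/seteqP; split=> phi.
  move=> /AutP[bij phiM]; split=> // x _ ij _ /=.
  by rewrite /bracket_defect mx_ofK phiM subrr linear0 mxE.
move=> [bij phiM]; apply/AutP; split=> // x; apply/eqP; rewrite -subr_eq0.
apply/eqP/(can_inj (@mx_ofK R L)); rewrite linear0; apply/matrixP => i j.
rewrite [RHS]mxE; have := phiM x I (i, j) I.
by rewrite /bracket_defect /= mx_ofK.
Qed.

End AutLie.

(** * Weights of an idempotent derivation *)

Section Weights.
Variables (R : numFieldType) (L : lieAlgType R) (E : 'End(L)).
Hypotheses (EE : (E \o E)%VF = E) (dE : der L E).

Definition weight (k : R) : set 'End(L) :=
  [set phi | der L phi /\ [Lie E, phi] = k *: phi].

(** In the decomposition of L into image and kernel of E, bracketing with E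
    multiplies the four blocks of phi by 0, 1, -1 and 0, all fixed by cubing. *)
Lemma lie_idem_cube (phi : 'End(L)) :
  [Lie E, [Lie E, [Lie E, phi]]] = [Lie E, phi].
Proof.
have EEE x : E (E x) = E x by rewrite -comp_lfunE EE.
apply/lfunP => x; rewrite !lie_endE !linearB /= !EEE.
set a := E (phi x); set b := E (phi (E x)); set c := phi (E x).
have cancel_b (V : zmodType) (u v w : V) :
    u - v + (- v - - v) + (- v - - v + (- - v - - - w)) = u - w.
  by rewrite !subrr !add0r addr0 !opprK addrA subrK.
exact: cancel_b.
Qed.

Lemma weight_subspace k : is_subspace (weight k).
Proof.
have [d0 dP] := der_subspace L.
split; first by split=> //; rewrite linear0 scaler0.
move=> a phi psi [dphi wphi] [dpsi wpsi]; split; first exact: dP.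
by rewrite linearP /= wphi wpsi scalerDr !scalerA mulrC.
Qed.

Lemma weight_lieb k l phi psi : weight k phi -> weight l psi ->
  weight (k + l) [Lie phi, psi].
Proof.
move=> [dphi wphi] [dpsi wpsi]; split.
  by have [_] := der_lie_subalgebra L; apply.
by rewrite lieb_leibniz wphi wpsi liebZl liebZr scalerDl.
Qed.

(** By [lie_idem_cube] every eigenvalue of [E, -] is a root of k^3 - k. *)
Lemma weight_eq0 k phi : k ^+ 3 != k -> weight k phi -> phi = 0.
Proof.
move=> k3 [_ wphi]; have := lie_idem_cube phi.
rewrite wphi !liebZr wphi !liebZr wphi !scalerA -expr2 -exprSr => /eqP.
by rewrite -subr_eq0 -scalerBl scaler_eq0 subr_eq0 (negPf k3) => /eqP.
Qed.

(** The bracket has weight 2k, and (2k)^3 - 2k = 6k is not 0 when k^2 = 1. *)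
Lemma lieb_weight_unit k phi psi : k ^+ 2 = 1 ->
  weight k phi -> weight k psi -> [Lie phi, psi] = 0.
Proof.
move=> k2 wphi wpsi; apply: weight_eq0 (weight_lieb wphi wpsi).
have k0 : k != 0.
  by apply/eqP => k0; move/eqP: k2; rewrite k0 expr0n eq_sym oner_eq0.
have -> : (k + k) ^+ 3 = (k + k) + 6 * k.
  transitivity (8 * (k ^+ 2 * k)); first by ring.
  by rewrite k2; ring.
by rewrite -subr_eq0 addrC addKr mulf_neq0// pnatr_eq0.
Qed.

Lemma weight_pm1_unique phi : weight 1 phi -> weight (-1) phi -> phi = 0.
Proof.
move=> [_ w1] [_]; rewrite w1 scaleN1r scale1r => /eqP.
by rewrite -addr_eq0 -mulr2n -scaler_nat scaler_eq0 pnatr_eq0 => /eqP.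
Qed.

(** For E idempotent [E, -] has only the eigenvalues -1, 0 and 1 on derivations,
    and its square is 1 exactly on the sum of the two odd ones. *)
Definition odd_der : set 'End(L) :=
  [set phi | der L phi /\ [Lie E, [Lie E, phi]] = phi].

Lemma der_adE phi : der L phi -> der L [Lie E, phi].
Proof. by have [_] := der_lie_subalgebra L; apply. Qed.

(** The components of phi in the weights 1 and -1 are the halves of
    phi + [E, phi] and phi - [E, phi]. *)
Lemma odd_derE : odd_der = sum_set (weight 1) (weight (-1)).
Proof.
have [_ dP] := der_subspace L.
apply/seteqP; split=> [phi [dphi aphi]|_ [q [dq wq] [p [dp wp] <-]]];
  last first.
  split; first by rewrite -[q]scale1r; exact: dP.
  rewrite !(liebDr q) wq wp liebDr !liebZr wq wp !scalerA mulrNN mul1r.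
  by rewrite !scale1r.
have dN : der L (- [Lie E, phi]).
  rewrite -scaleN1r; apply: (is_subspaceZ _ (der_subspace L)).
  exact: der_adE.
have sD := der_subspace L.
exists (2^-1 *: (phi + [Lie E, phi])).
  split; last by rewrite liebZr (liebDr phi) aphi scale1r addrC.
  by apply: (is_subspaceZ _ sD); apply: (is_subspaceD sD) => //; exact: der_adE.
exists (2^-1 *: (phi - [Lie E, phi])).
  split; last first.
    by rewrite liebZr (liebDr phi) liebNr aphi scaleN1r -scalerN opprB.
  by apply: (is_subspaceZ _ sD); exact: (is_subspaceD sD).
have halfK (V : lmodType R) (u : V) : 2^-1 *: (u + u) = u.
  by rewrite -mulr2n -(scaler_nat 2 u) scalerA mulVf ?pnatr_eq0// scale1r.
by rewrite -scalerDr addrACA subrr addr0 halfK.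
Qed.

Lemma direct_odd : direct_sum odd_der (weight 1) (weight (-1)).
Proof.
split; [exact: weight_subspace|exact: weight_subspace|exact: odd_derE|].
apply/seteqP; split=> [phi []|_ ->].
  exact: weight_pm1_unique.
by split; have [] := weight_subspace 1; have [] := weight_subspace (-1).
Qed.

(** The splitting phi = (phi - [E, [E, phi]]) + [E, [E, phi]] has its first
    term in weight 0 and its second one in the odd part by [lie_idem_cube]. *)
Lemma direct_der : direct_sum (der L) (weight 0) odd_der.
Proof.
have sD := der_subspace L.
have sO : is_subspace odd_der.
  by rewrite odd_derE; apply: sum_set_subspace; exact: weight_subspace.
split=> //; first exact: weight_subspace.
  apply/seteqP; split=> [phi dphi|_ [u [du _] [v [dv _] <-]]];
    last exact: (is_subspaceD sD).
  have daa : der L [Lie E, [Lie E, phi]] by apply: der_adE; exact: der_adE.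
  exists (phi - [Lie E, [Lie E, phi]]).
    split; first by apply: (is_subspaceD sD) => //; exact: (is_subspaceN sD).
    by rewrite (liebDr phi) liebNr lie_idem_cube subrr scale0r.
  exists [Lie E, [Lie E, phi]]; last by rewrite subrK.
  by split=> //; rewrite lie_idem_cube.
apply/seteqP; split=> [phi [[_ w0] [_ <-]]|_ ->].
  by rewrite w0 scale0r linear0.
by split; [have [] := weight_subspace 0|have [] := sO].
Qed.

Lemma direct_weight0 k : k ^+ 2 = 1 ->
  direct_sum (sum_set (weight 0) (weight k)) (weight 0) (weight k).
Proof.
move=> k2; split=> //; [exact: weight_subspace|exact: weight_subspace|].
apply/seteqP; split=> [phi [[_ w0] [_ wk]]|_ ->].
  move/eqP: w0; rewrite scale0r wk scaler_eq0 => /orP[/eqP k0|/eqP//].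
  by move/eqP: k2; rewrite k0 expr0n eq_sym oner_eq0.
by split; [have [] := weight_subspace 0|have [] := weight_subspace k].
Qed.

Lemma weight_lieb_eq k l m phi psi : k + l = m ->
  weight k phi -> weight l psi -> weight m [Lie phi, psi].
Proof. by move=> <-; exact: weight_lieb. Qed.

Lemma graded_der : Z2_graded (der L) (grading (weight 0) odd_der).
Proof.
have N1 : (-1) ^+ 2 = 1 :> R by rewrite sqrrN expr1n.
apply: (Z2_gradedI direct_der) => phi psi.
- by apply: weight_lieb_eq; rewrite addr0.
- move=> w; rewrite odd_derE => -[q wq [p wp <-]].
  exists [Lie phi, q]; first exact: (weight_lieb_eq (add0r _) w wq).
  exists [Lie phi, p]; first exact: (weight_lieb_eq (add0r _) w wp).
  by rewrite (liebDr q).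
- rewrite odd_derE => -[q wq [p wp <-]] [q' wq' [p' wp' <-]].
  rewrite (liebDl q) !(liebDr q') (lieb_weight_unit (expr1n _ 2) wq wq').
  rewrite (lieb_weight_unit N1 wp wp') add0r addr0.
  apply: (is_subspaceD (weight_subspace 0)).
    exact: (weight_lieb_eq (subrr 1) wq wp').
  exact: (weight_lieb_eq (addNr 1) wp wq').
Qed.

Lemma superalgebra_weight k : k ^+ 2 = 1 ->
  lie_superalgebra (sum_set (weight 0) (weight k))
    (grading (weight 0) (weight k)).
Proof.
move=> k2; apply: lie_superalgebraI; last first.
  by move=> phi psi; exact: lieb_weight_unit.
apply: (Z2_gradedI (direct_weight0 k2)) => phi psi.
- by apply: weight_lieb_eq; rewrite addr0.
- by apply: weight_lieb_eq; rewrite add0r.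
- move=> w w'; rewrite (lieb_weight_unit k2 w w').
  by have [] := weight_subspace 0.
Qed.

Lemma abelian_weight k : k ^+ 2 = 1 -> abelian_subalgebra (weight k).
Proof.
move=> k2; split; last by move=> phi psi; exact: lieb_weight_unit.
split; first exact: weight_subspace.
move=> phi psi w w'; rewrite (lieb_weight_unit k2 w w').
by have [] := weight_subspace k.
Qed.

Lemma weight0_subalgebra : lie_subalgebra (weight 0).
Proof.
split; first exact: weight_subspace.
by move=> phi psi; apply: weight_lieb_eq; rewrite addr0.
Qed.

End Weights.

(** * Endomorphisms of the cotangent Lie algebra by blocks *)

Section LinearMaps.
Variables (R : fieldType).

Lemma linear_Hom (U V : vectType R) (f : U -> V) :
  linear f -> exists F : 'Hom(U, V), F =1 f.
Proof.
move=> lf; pose h := GRing.isLinear.Build _ _ _ _ f lf.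
exists (linfun (HB.pack f h : {linear U -> V})) => x.
by rewrite lfunE.
Qed.

End LinearMaps.

Section Blocks.
Variables (R : fieldType) (g : lieAlgType R).
Local Notation D := (cotangent g).

Lemma coadDl (x y : g) (f : dual g) : coad (x + y) f = coad x f + coad y f.
Proof.
by apply/lfunP => z; rewrite add_lfunE !coadE liebDl linearD opprD.
Qed.

Lemma coadDr (x : g) (f h : dual g) : coad x (f + h) = coad x f + coad x h.
Proof. by apply/lfunP => z; rewrite !(add_lfunE, coadE) opprD. Qed.

Lemma coad0l (f : dual g) : coad 0 f = 0.
Proof. by apply: (addrI (coad 0 f)); rewrite -coadDl !addr0. Qed.

Lemma coad0r (x : g) : coad x 0 = 0.
Proof. by apply: (addrI (coad x 0)); rewrite -coadDr !addr0. Qed.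

Lemma cot_liebE (x y : g) (f h : dual g) :
  [Lie (x, f) : D, (y, h) : D] = ([Lie x, y], coad x h - coad y f).
Proof. by []. Qed.

Lemma addcE (x y : g) (f h : dual g) : (x, f) + (y, h) = (x + y, f + h) :> D.
Proof. by []. Qed.

Definition has_blocks (phi : 'End(D)) (alpha : 'End(g)) (beta : 'Hom(g, dual g))
    (psi : 'Hom(dual g, g)) (xi : 'End(dual g)) :=
  forall (x : g) (f : dual g), phi (x, f) = (alpha x + psi f, beta x + xi f).

Lemma exists_blocks (phi : 'End(D)) :
  exists (alpha : 'End(g)) (beta : 'Hom(g, dual g)) (psi : 'Hom(dual g, g))
    (xi : 'End(dual g)), has_blocks phi alpha beta psi xi.
Proof.
have addg (a : R) (x y : g) : (a *: x + y, 0) = a *: (x, 0) + (y, 0) :> D.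
  by apply/pair_equal_spec; rewrite /= scaler0 addr0.
have addf (a : R) (f h : dual g) : (0, a *: f + h) = a *: (0, f) + (0, h) :> D.
  by apply/pair_equal_spec; rewrite /= scaler0 addr0.
have [|alpha alphaE] := @linear_Hom R g g (fun x => (phi (x, 0)).1).
  by move=> a x y; rewrite addg linearP.
have [|beta betaE] := @linear_Hom R g (dual g) (fun x => (phi (x, 0)).2).
  by move=> a x y; rewrite addg linearP.
have [|psi psiE] := @linear_Hom R (dual g) g (fun f => (phi (0, f)).1).
  by move=> a x y; rewrite addf linearP.
have [|xi xiE] := @linear_Hom R (dual g) (dual g) (fun f => (phi (0, f)).2).
  by move=> a x y; rewrite addf linearP.
exists alpha, beta, psi, xi => x f; rewrite alphaE betaE psiE xiE.
have -> : (x, f) = (x, 0) + (0, f) :> D by rewrite addcE addr0 add0r.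
by rewrite linearD.
Qed.

(** It suffices to test the Leibniz rule on pairs of elements of g and g'. The
    pairs (g, g) give the conditions on alpha and beta, the pairs (g, g') those
    linking psi and xi to ad and coad, and the pairs (g', g'), on which
    the bracket vanishes, the symmetry of psi. *)
Lemma der_blocksP phi alpha beta psi xi : has_blocks phi alpha beta psi xi ->
  der D phi <-> [/\ der g alpha, Q_cocycles g beta, Psi_maps g psi &
    forall (x : g) (f : dual g),
      xi (coad x f) = coad (alpha x) f + coad x (xi f)].
Proof.
move=> phiE; split=> [dphi|[dalpha cbeta [psi_ad psi_sym] xi_coad] [x f] [y h]].
  split.
  - move=> x y; have := dphi (x, 0) (y, 0).
    by rewrite !(cot_liebE, phiE) !(coad0r, subrr, linear0, addr0) => /= -[].
  - move=> x y; have := dphi (x, 0) (y, 0).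
    rewrite !(cot_liebE, phiE) !(coad0r, subrr, linear0, addr0) => /= -[_ ->].
    by rewrite sub0r addrC.
  - split=> [x f|f h].
      have := dphi (x, 0) (0, f).
      rewrite !(cot_liebE, phiE) !(coad0l, coad0r, subr0, linear0, addr0, add0r).
      by move=> /= -[-> _]; rewrite add0r.
    have := dphi (0, f) (0, h).
    rewrite !(cot_liebE, phiE) !(coad0l, coad0r, subr0, linear0, addr0, add0r).
    move=> /= -[_ /esym/eqP]; by rewrite subr_eq0 => /eqP.
  - move=> x f; have := dphi (x, 0) (0, f).
    rewrite !(cot_liebE, phiE) !(coad0l, coad0r, subr0, linear0, addr0, add0r).
    by move=> /= -[].
rewrite !(cot_liebE, phiE) addcE; apply/pair_equal_spec; split.
  rewrite dalpha linearB /= !psi_ad !(liebDl, liebDr) (liebC (psi f)).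
  by rewrite -!addrA; congr (_ + _); rewrite [RHS]addrC addrA.
rewrite cbeta linearB /= !xi_coad !(coadDl, coadDr) (psi_sym f h).
set a := coad x (beta y); set b := coad y (beta x); set c := coad (psi h) f.
set d := coad (alpha x) h; set e := coad x (xi h).
set k := coad (alpha y) f; set l := coad y (xi f).
have shuffle (V : zmodType) (p q r s t u v : V) :
    p - q + (s + t - (u + v)) = s + r - (q + v) + (p + t - (u + r)).
  rewrite !opprD [RHS](AC ((2*2)*(2*2)) ((5*3)*((1*6)*(7*4))*(2*8)))/=.
  by rewrite subrr addr0.
exact: shuffle.
Qed.

End Blocks.

Section Transpose.
Variables (R : fieldType) (g : lieAlgType R).

Definition coordf (i : 'I_(\dim {:g})) : dual g :=
  linfun (coord (vbasis {:g}) i : g -> R^o).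

Lemma coordfE i x : coordf i x = coord (vbasis {:g}) i x.
Proof. by rewrite /coordf lfunE. Qed.

Lemma dual_expand (f : dual g) :
  f = \sum_(i < \dim {:g}) f (vbasis {:g})`_i *: coordf i.
Proof.
apply/lfunP => x; rewrite [in LHS](coord_vbasis (memvf x)) linear_sum sum_lfunE.
by apply: eq_bigr => i _; rewrite linearZ scale_lfunE coordfE; exact: mulrC.
Qed.

Lemma dual_inj (x y : g) : (forall f : dual g, f x = f y) -> x = y.
Proof.
move=> fxy; rewrite (coord_vbasis (memvf x)) (coord_vbasis (memvf y)).
by apply: eq_bigr => i _; rewrite -!coordfE fxy.
Qed.

(** Finite dimension makes every endomorphism of g' a transpose: in a basis
    (e_i) with dual basis (c_i), t z is the sum of the xi(c_i)(z) e_i. *)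
Lemma exists_transpose (xi : 'End(dual g)) :
  exists t : 'End(g), forall f : dual g, xi f = (f \o t)%VF.
Proof.
have [|t tE] := @linear_Hom R g g
  (fun z => \sum_(i < \dim {:g}) xi (coordf i) z *: (vbasis {:g})`_i).
  move=> a x y; rewrite scaler_sumr -big_split /=; apply: eq_bigr => i _.
  by rewrite linearP /= scalerDl scalerA.
exists t => f; apply/lfunP => z; rewrite comp_lfunE tE [in LHS](dual_expand f).
rewrite !linear_sum sum_lfunE; apply: eq_bigr => i _.
rewrite !linearZ scale_lfunE; exact: mulrC.
Qed.

End Transpose.

(** * The degree derivation of the cotangent Lie algebra *)

Section Degree.
Variables (R : numFieldType) (g : lieAlgType R).
Local Notation D := (cotangent g).

Definition fiber_part (u : D) : D := (0, u.2).

Fact fiber_part_linear : linear fiber_part.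
Proof.
by move=> a u v; apply/pair_equal_spec; rewrite /= scaler0 addr0.
Qed.

HB.instance Definition _ :=
  GRing.isLinear.Build R D D _ fiber_part fiber_part_linear.

(** Multiplication by the degree on g + g', where g has degree 0 and g'
    degree 1. *)
Definition degree : 'End(D) := linfun fiber_part.

Lemma degreeE (x : g) (f : dual g) : degree (x, f) = (0, f).
Proof. by rewrite lfunE. Qed.

Lemma degree_idem : (degree \o degree)%VF = degree.
Proof. by apply/lfunP => -[x f]; rewrite comp_lfunE !degreeE. Qed.

Lemma degree_der : der D degree.
Proof.
have blocks : has_blocks degree 0 0 0 \1.
  by move=> x f; rewrite degreeE !zero_lfunE id_lfunE !add0r.
apply/(der_blocksP blocks); split.
- by move=> x y; rewrite !zero_lfunE lieb0l lieb0r addr0.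
- by move=> x y; rewrite !zero_lfunE !coad0r subr0.
- by split=> [x f|f h]; rewrite !zero_lfunE ?lieb0r ?coad0l.
- by move=> x f; rewrite !id_lfunE zero_lfunE coad0l add0r.
Qed.

Lemma lie_degree phi alpha beta psi xi : has_blocks phi alpha beta psi xi ->
  forall (x : g) (f : dual g), [Lie degree, phi] (x, f) = (- psi f, beta x).
Proof.
move=> phiE x f; rewrite lie_endE degreeE !phiE degreeE !linear0 !add0r.
by apply/pair_equal_spec; rewrite /= sub0r addrK.
Qed.

(** [E, phi] negates the block psi, keeps beta and kills the diagonal blocks,
    so the eigenvalue equation splits into one equation for each block. *)
Lemma weight_blocksP k phi alpha beta psi xi :
  has_blocks phi alpha beta psi xi ->
  weight degree k phi <->
  [/\ der D phi, forall x, 0 = k *: alpha x, forall x, beta x = k *: beta x,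
    forall f, - psi f = k *: psi f & forall f, 0 = k *: xi f].
Proof.
move=> phiE; have adE := lie_degree phiE.
split=> [[dphi wphi]|[dphi alphaE betaE psiE xiE]]; last first.
  split=> //; apply/lfunP => -[x f].
  rewrite adE scale_lfunE phiE; apply/pair_equal_spec; rewrite /=.
  by rewrite !scalerDr -alphaE -betaE -psiE -xiE add0r addr0.
have wE x f :
    (- psi f, beta x) = (k *: (alpha x + psi f), k *: (beta x + xi f)).
  by rewrite -adE wphi scale_lfunE phiE.
split=> // [x|x|f|f].
- by have [+ _] := wE x 0; rewrite !linear0 addr0.
- by have [_] := wE x 0; rewrite !linear0 addr0.
- by have [+ _] := wE 0 f; rewrite !linear0 add0r.
- by have [_] := wE 0 f; rewrite !linear0 add0r.
Qed.

Lemma J_mapsC (j : 'End(g)) x y : J_maps g j -> j [Lie x, y] = [Lie x, j y].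
Proof. by move=> jJ; rewrite liebC linearN /= jJ -liebC. Qed.

(** For xi the transpose of j - alpha, the condition on xi in [der_blocksP] is
    dual to j [x, y] = [x, j y] once alpha is a derivation. Conversely
    j = alpha + t when xi is the transpose of t. *)
Lemma G0E : G0 g = weight degree 0.
Proof.
apply/seteqP; split=> phi.
  move=> [alpha [j [dalpha jJ phiE]]].
  have [|xi xiE] := @linear_Hom R (dual g) (dual g)
      (fun f => (f \o (j - alpha))%VF).
    by move=> a f h; rewrite comp_lfunDl comp_lfunZl.
  have blocks : has_blocks phi alpha 0 0 xi.
    by move=> x f; rewrite phiE !zero_lfunE addr0 add0r xiE.
  apply/(weight_blocksP _ blocks); split; last 4 first.
  - by move=> x; rewrite scale0r.
  - by move=> x; rewrite scale0r zero_lfunE.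
  - by move=> f; rewrite scale0r zero_lfunE oppr0.
  - by move=> f; rewrite scale0r.
  apply/(der_blocksP blocks); split=> //.
  - by move=> x y; rewrite !zero_lfunE !coad0r subr0.
  - by split=> [x f|f h]; rewrite !zero_lfunE ?lieb0r ?coad0l.
  (* What is left is [x, (j - alpha) z] = [alpha x, z] + (j - alpha) [x, z]. *)
  move=> x f; apply/lfunP => z.
  rewrite !xiE add_lfunE !(comp_lfunE, coadE) !(add_lfunE, opp_lfunE).
  rewrite -opprD -linearD; congr (- f _).
  rewrite linearB /= -J_mapsC// dalpha opprD addrCA [_ + (- _ - _)]addrA.
  by rewrite subrr add0r.
have [alpha [beta [psi [xi phiE]]]] := exists_blocks phi.
move=> /(weight_blocksP _ phiE) [/(der_blocksP phiE) [dalpha _ _ xi_coad] _].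
move=> beta0 psi0 _; have [t tE] := exists_transpose xi.
exists alpha, (alpha + t); split=> //; last first.
  move=> x f; rewrite phiE beta0 scale0r add0r [alpha + t]addrC addrK -tE.
  by rewrite -[psi f]opprK psi0 scale0r oppr0 addr0.
move=> x y; apply: dual_inj => f.
have := congr1 (fun h : dual g => h x) (xi_coad y f).
rewrite !tE add_lfunE !(comp_lfunE, coadE) !add_lfunE !coadE comp_lfunE.
rewrite dalpha liebDl (liebC x y) (liebC x (alpha y)) (liebC (t x)).
by rewrite !linearD !linearN /= => ->; rewrite addrA.
Qed.

Lemma calQE : calQ g = weight degree 1.
Proof.
apply/seteqP; split=> phi.
  move=> [beta cbeta phiE].
  have blocks : has_blocks phi 0 beta 0 0.
    by move=> x f; rewrite phiE !zero_lfunE !addr0.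
  apply/(weight_blocksP _ blocks); split; last 4 first.
  - by move=> x; rewrite zero_lfunE scaler0.
  - by move=> x; rewrite scale1r.
  - by move=> f; rewrite zero_lfunE scaler0 oppr0.
  - by move=> f; rewrite zero_lfunE scaler0.
  apply/(der_blocksP blocks); split=> //.
  - by move=> x y; rewrite !zero_lfunE lieb0l lieb0r addr0.
  - by split=> [x f|f h]; rewrite !zero_lfunE ?lieb0r ?coad0l.
  - by move=> x f; rewrite !zero_lfunE coad0l coad0r addr0.
have [alpha [beta [psi [xi phiE]]]] := exists_blocks phi.
move=> /(weight_blocksP _ phiE) [/(der_blocksP phiE) [_ cbeta _ _]].
move=> alpha0 _ psi0 xi0; exists beta => // x f; rewrite phiE.
have := psi0 f; have := alpha0 x; have := xi0 f.
rewrite !scale1r => <- <- /eqP; rewrite eq_sym -addr_eq0 -mulr2n.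
rewrite -(scaler_nat 2 (psi f)) scaler_eq0 pnatr_eq0 => /eqP ->.
by rewrite !addr0.
Qed.

Lemma calPsiE : calPsi g = weight degree (-1).
Proof.
apply/seteqP; split=> phi.
  move=> [psi psiP phiE].
  have blocks : has_blocks phi 0 0 psi 0.
    by move=> x f; rewrite phiE !zero_lfunE !add0r.
  apply/(weight_blocksP _ blocks); split; last 4 first.
  - by move=> x; rewrite zero_lfunE scaler0.
  - by move=> f; rewrite zero_lfunE scaler0.
  - by move=> x; rewrite scaleN1r.
  - by move=> f; rewrite zero_lfunE scaler0.
  apply/(der_blocksP blocks); split=> //.
  - by move=> x y; rewrite !zero_lfunE lieb0l lieb0r addr0.
  - by move=> x y; rewrite !zero_lfunE !coad0r subr0.
  - by move=> x f; rewrite !zero_lfunE coad0l coad0r addr0.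
have [alpha [beta [psi [xi phiE]]]] := exists_blocks phi.
move=> /(weight_blocksP _ phiE) [/(der_blocksP phiE) [_ _ psiP _]].
move=> alpha0 beta0 _ xi0; exists psi => // x f; rewrite phiE.
have := beta0 x; have := alpha0 x; have := xi0 f.
rewrite !scaleN1r => /eqP; rewrite eq_sym oppr_eq0 => /eqP ->.
move=> /eqP; rewrite eq_sym oppr_eq0 => /eqP -> /eqP.
rewrite -addr_eq0 -mulr2n -(scaler_nat 2 (beta x)) scaler_eq0 pnatr_eq0.
by move=> /eqP ->; rewrite !(addr0, add0r).
Qed.

End Degree.

(** * The grading of the derivations of the cotangent Lie algebra *)

Theorem theoremB (R : realType) (g : lieAlgType R) :
  [/\ super_symmetric_lie_group (Aut (cotangent g)) (grading (G0 g) (G1 g)),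
      lie_algebra_of (Aut (cotangent g)) = der (cotangent g) &
      Z2_graded (der (cotangent g)) (grading (G0 g) (G1 g))] /\
  lie_subalgebra (G0 g) /\
  direct_sum (G1 g) (calQ g) (calPsi g) /\
  [/\ abelian_subalgebra (calQ g), (calQ g `<=` der (cotangent g))%classic,
      abelian_subalgebra (calPsi g) & (calPsi g `<=` der (cotangent g))%classic] /\
  [/\ lie_superalgebra (sum_set (G0 g) (calQ g)) (grading (G0 g) (calQ g)),
      (sum_set (G0 g) (calQ g) `<=` der (cotangent g))%classic,
      lie_superalgebra (sum_set (G0 g) (calPsi g)) (grading (G0 g) (calPsi g)) &
      (sum_set (G0 g) (calPsi g) `<=` der (cotangent g))%classic].
Proof.
have NN1 : (-1) ^+ 2 = 1 :> R by rewrite sqrrN expr1n.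
have N1 : 1 ^+ 2 = 1 :> R by rewrite expr1n.
have EE := degree_idem g; have dE := @degree_der R g.
have G1E : G1 g = odd_der (degree g).
  by rewrite /G1 calQE calPsiE (odd_derE dE).
have autE : lie_algebra_of (Aut (cotangent g)) = der (cotangent g).
  exact: lie_algebra_of_Aut.
have gr : Z2_graded (der (cotangent g)) (grading (G0 g) (G1 g)).
  by rewrite G0E G1E; exact: (graded_der EE dE).
have sub_der k : sum_set (weight (degree g) 0) (weight (degree g) k)
    `<=` der (cotangent g).
  move=> _ [u [du _] [v [dv _] <-]].
  exact: (is_subspaceD (der_subspace _)).
split.
  split; [|exact: autE|exact: gr].
  by split; [exact: closed_Aut | rewrite autE].
rewrite G1E G0E calQE calPsiE; split; first exact: weight0_subalgebra.
split; first exact: (direct_odd dE).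
split.
  split; [exact: (abelian_weight EE N1)|by move=> phi []| |by move=> phi []].
  exact: (abelian_weight EE NN1).
split; [|exact: sub_der| |exact: sub_der].
  exact: (superalgebra_weight EE N1).
exact: (superalgebra_weight EE NN1).
Qed.
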